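(* For all integers $m\ge k\ge 2$ and all positive integers $n$ with $2m>(k-1)n$, there exist a measurable space $(\Omega,\mathcal{F})$ and a mixture of measures $\mathcal{P}=\sum_{i=1}^m a_i\delta_{\mu_i}$ on it (with $m$ distinct components $\mu_1,\dots,\mu_m$, all weights $a_i>0$) such that $\mu_1,\dots,\mu_m$ are $k$-independent and $\mathcal{P}$ is not $n$-determined.
   Context: Given a measurable space $(\Omega,\mathcal{F})$, let $\mathcal{D}$ be the set of probability measures on $(\Omega,\mathcal{F})$, viewed as a subset of the real vector space of finite signed measures on $(\Omega,\mathcal{F})$, and equip $\mathcal{D}$ with its power-set $\sigma$-algebra. A mixture of measures is a probability measure on $\mathcal{D}$ of the form $\mathcal{P}=\sum_{i=1}^m a_i\delta_{\mu_i}$, where $m<\infty$, $\mu_i\in\mathcal{D}$, $a_i>0$, $\sum_{i=1}^m a_i=1$, and $\delta_{\mu}$ is the Dirac measure at $\mu$. Representations are always taken minimal, i.e. the $\mu_i$ are pairwise distinct; the $\mu_i$ are called the (mixture) components and $m$ is the number of components. Two mixtures of measures are equal when they are equal as measures on $\mathcal{D}$. For a positive integer $n$, define $V_n(\mathcal{P})=\sum_{i=1}^m a_i\mu_i^{\times n}$, a probability measure on $(\Omega^{n},\mathcal{F}^{\times n})$ (product $\sigma$-algebra), where $\mu_i^{\times n}$ is the $n$-fold product measure. A mixture of measures $\mathcal{P}$ is $n$-determined if there is no mixture of measures $\mathcal{P}'\ne\mathcal{P}$ on the same space (with any finite number of components) such that $V_n(\mathcal{P}')=V_n(\mathcal{P})$.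 A sequence of vectors $x_1,\dots,x_m$ in a vector space is $k$-independent (where $k\le m$) if every subsequence consisting of $k$ of the vectors is linearly independent. *)

(* Defs.v *)
From HB Require Import structures.
From mathcomp Require Import all_boot all_order all_algebra.
From mathcomp Require Import all_classical all_reals all_analysis.

Set Implicit Arguments.
Unset Strict Implicit.
Unset Printing Implicit Defensive.

Import Order.TTheory GRing.Theory Num.Theory.
Import numFieldNormedType.Exports.

Local Open Scope classical_set_scope.
Local Open Scope ring_scope.

Definition lin_indep (K : fieldType) (V : lmodType K) (n : nat)
    (x : 'I_n -> V) :=
  forall c : 'I_n -> K, \sum_(i < n) c i *: x i = 0 -> forall i, c i = 0.

Definition k_independent (K : fieldType) (V : lmodType K) (k m : nat)
    (x : 'I_m -> V) :=
  forall s : 'I_k -> 'I_m, {homo s : i j / (i < j)%N} -> lin_indep (x \o s).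

(* Set functions in the library are defined on all of [set T], including the
   non-measurable sets, so that Leibniz equality of two of them is finer than
   their equality as measures. *)
Definition eq_meas d (T : measurableType d) (R : realType)
    (mu nu : set T -> \bar R) :=
  forall A, measurable A -> mu A = nu A.

(* The signed measure [nu] as a real-valued function, canonically extended by 0
   to the non-measurable sets. *)
Definition real_set_fun d (T : measurableType d) (R : realType)
    (nu : set T -> \bar R) : set T -> R^o :=
  fun A => if `[< measurable A >] then fine (nu A) else 0.

Section signed_measures.
Context d (T : measurableType d) (R : realType).

Definition is_signed_measure : {pred (set T -> R^o)} :=
  fun f => `[< exists nu : {charge set T -> \bar R}, f = real_set_fun nu >].

Lemma is_signed_measure_submod : submod_closed is_signed_measure.
Proof.
split=> [|a f g /asboolP[nu ->] /asboolP[nu' ->]]; apply/asboolP.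
- exists (czero : {charge set T -> \bar R}).
  by apply/funext => A; rewrite /real_set_fun; case: ifP.
- exists (cadd (cscale a nu) nu' : {charge set T -> \bar R}).
  apply/funext => A; rewrite /real_set_fun/= /cadd/= /cscale/=.
  rewrite [LHS]/GRing.add/=.
  rewrite [X in X + _]/GRing.scale/=.
  case: asboolP => mA; last by rewrite scaler0 addr0.
  rewrite fineD ?fin_numM ?fin_num_measure//.
  by rewrite fineM ?fin_num_measure.
Qed.

HB.instance Definition _ :=
  GRing.isSubmodClosed.Build R (set T -> R^o) is_signed_measure
    is_signed_measure_submod.

Record signed_measure := SignedMeasure {
  signed_measure_val :> set T -> R^o ;
  _ : signed_measure_val \in is_signed_measure }.

HB.instance Definition _ := [isSub for signed_measure_val].
HB.instance Definition _ := [Choice of signed_measure by <:].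
HB.instance Definition _ := [SubChoice_isSubLmodule of signed_measure by <:].

End signed_measures.

Section canonical_restriction.
Context d (T : measurableType d) (R : realType) (mu : probability T R).
Local Open Scope ereal_scope.

Definition prob_restr (A : set T) : \bar R :=
  if `[< measurable A >] then mu A else 0.

Lemma prob_restrE A : measurable A -> prob_restr A = mu A.
Proof. by move=> mA; rewrite /prob_restr asboolT. Qed.

Let prob_restr0 : prob_restr set0 = 0.
Proof. by rewrite prob_restrE// measure0. Qed.

Let prob_restr_ge0 A : 0 <= prob_restr A.
Proof. by rewrite /prob_restr; case: ifP. Qed.

Let prob_restr_sigma_additive : semi_sigma_additive prob_restr.
Proof.
move=> F mF tF mUF; rewrite prob_restrE//.
under eq_fun do under eq_bigr do rewrite prob_restrE//.
exact: measure_semi_sigma_additive.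
Qed.

HB.instance Definition _ := isMeasure.Build _ _ _ prob_restr
  prob_restr0 prob_restr_ge0 prob_restr_sigma_additive.

Let prob_restrT : prob_restr setT = 1.
Proof. by rewrite prob_restrE// probability_setT. Qed.

HB.instance Definition _ :=
  Measure_isProbability.Build _ _ _ prob_restr prob_restrT.

End canonical_restriction.

Lemma eq_probability d (T : measurableType d) (R : realType)
    (P Q : probability T R) : (P = Q :> (set T -> \bar R)) -> P = Q.
Proof.
move: P Q => [P [[p0 pge0] [psa] [psf] [psig] [pf] [ps] [pT]]].
move=> [Q [[q0 qge0] [qsa] [qsf] [qsig] [qf] [qs] [qT]]] /= PQ; subst Q.
by rewrite (Prop_irrelevance q0 p0) (Prop_irrelevance qge0 pge0)
  (Prop_irrelevance qsa psa) (Prop_irrelevance qsf psf)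
  (Prop_irrelevance qsig psig) (Prop_irrelevance qf pf)
  (Prop_irrelevance qs ps) (Prop_irrelevance qT pT).
Qed.

(* The set D of probability measures on T. Each measure is represented by its
   extension by 0 to the non-measurable sets, so that Leibniz equality on D
   is equality of measures ([prob_measP]) and every probability measure is
   represented ([prob_meas_ofE]). *)
Record prob_meas d (T : measurableType d) (R : realType) := ProbMeas {
  prob_meas_val :> probability T R ;
  prob_meas_out : forall A, ~ measurable A -> prob_meas_val A = 0%E }.

Section prob_meas_theory.
Context d (T : measurableType d) (R : realType).
Implicit Types mu nu : prob_meas T R.

Lemma prob_restr_out (mu : probability T R) A :
  ~ measurable A -> prob_restr mu A = 0%E.
Proof. by move=> nmA; rewrite /prob_restr asboolF. Qed.

Definition prob_meas_of (mu : probability T R) : prob_meas T R :=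
  @ProbMeas _ _ _ (prob_restr mu) (@prob_restr_out mu).

Lemma prob_meas_ofE (mu : probability T R) : eq_meas (prob_meas_of mu) mu.
Proof. by move=> A mA; exact: prob_restrE. Qed.

Lemma prob_measP mu nu : mu = nu <-> eq_meas mu nu.
Proof.
split=> [->//|]; case: mu nu => [mu mu0] [nu nu0] /= munu.
have {}munu : mu = nu.
  apply/eq_probability/funext => A; have [mA|nmA] := pselect (measurable A).
    exact: munu.
  by rewrite mu0// nu0.
by subst nu; congr ProbMeas; exact: Prop_irrelevance.
Qed.

Lemma signed_meas_of_subproof mu :
  real_set_fun mu \in @is_signed_measure _ T R.
Proof. by apply/asboolP; exists (charge_of_finite_measure mu). Qed.

Definition signed_meas_of mu : signed_measure T R :=
  SignedMeasure (signed_meas_of_subproof mu).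

Lemma signed_comb_eq0P n (c : 'I_n -> R) (mu : 'I_n -> prob_meas T R) :
  \sum_(i < n) c i *: signed_meas_of (mu i) = 0 <->
  forall A, measurable A -> \sum_(i < n) c i * fine (mu i A) = 0.
Proof.
have E A : signed_measure_val (\sum_(i < n) c i *: signed_meas_of (mu i)) A =
    \sum_(i < n) c i * real_set_fun (mu i) A.
  by rewrite (@big_morph _ _
    (fun x : signed_measure T R => signed_measure_val x A) 0 +%R).
split=> [c0 A mA|c0].
  have := E A; rewrite c0 => /esym.
  by under eq_bigr do rewrite /real_set_fun asboolT//; move=> ->.
apply/val_inj/funext => A /=; rewrite E /real_set_fun.
by case: asboolP => mA; [exact: c0|rewrite big1// => i _; rewrite mulr0].
Qed.

HB.instance Definition _ := gen_eqMixin (prob_meas T R).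
HB.instance Definition _ := gen_choiceMixin (prob_meas T R).
HB.instance Definition _ :=
  isPointed.Build (prob_meas T R) (prob_meas_of point).

HB.instance Definition _ := @isMeasurable.Build default_measure_display
  (prob_meas T R) discrete_measurable discrete_measurable0
  discrete_measurableC discrete_measurableU.

End prob_meas_theory.

Section cons_pair.
Context d (T : measurableType d) (n : nat).

Definition cons_pair (x : T * n.-tuple T) : n.+1.-tuple T :=
  [tuple of x.1 :: x.2].

Let measurable_cons_pair : measurable_fun setT cons_pair.
Proof. exact: (measurable_cons measurable_fst measurable_snd). Qed.

HB.instance Definition _ :=
  isMeasurableFun.Build _ _ _ _ cons_pair measurable_cons_pair.

End cons_pair.

(* The n-fold product measure, on the product sigma-algebra of [n.-tuple T];
   see [meas_powerE] for its values on rectangles. *)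
Fixpoint meas_power d (T : measurableType d) (R : realType)
    (mu : probability T R) (n : nat) : probability (n.-tuple T) R :=
  match n with
  | 0 => dirac [tuple]
  | n'.+1 => distribution (mu \x meas_power mu n')%E (@cons_pair _ T n')
  end.

Lemma measurable_rect d (T : measurableType d) n (A : 'I_n -> set T) :
  (forall i, measurable (A i)) ->
  measurable [set t : n.-tuple T | forall i, A i (tnth t i)].
Proof.
move=> mA.
rewrite (_ : mkset _ =
    \bigcap_(i in setT) ((fun t : n.-tuple T => tnth t i) @^-1` A i)).
  apply: fin_bigcap_measurable => // i _.
  by rewrite -[X in measurable X]setTI; exact: measurable_tnth.
by apply/seteqP; split => t tA i //=; exact: tA.
Qed.

Lemma meas_powerE d (T : measurableType d) (R : realType)
    (mu : probability T R) n (A : 'I_n -> set T) :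
  (forall i, measurable (A i)) ->
  meas_power mu n [set t | forall i, A i (tnth t i)] =
  (\prod_(i < n) mu (A i))%E.
Proof.
elim: n A => [|n IHn] A mA /=.
  by rewrite big_ord0 diracE mem_set// => -[].
have mA' (i : 'I_n) : measurable (A (lift ord0 i)) by exact: mA.
rewrite big_ord_recl -(IHn _ mA').
rewrite -(product_measure1E mu (meas_power mu n) (mA ord0)
  (measurable_rect mA')).
rewrite /distribution /pushforward; congr (product_measure1 _ _ _).
apply/seteqP; split => -[x t] /= xtA.
  by split=> [|i]; [exact: (xtA ord0)|have := xtA (lift ord0 i); rewrite tnthS].
case: xtA => xA tA i; case: (unliftP ord0 i) => [j ->|->] //.
by rewrite tnthS; exact: tA.
Qed.

(* A minimal representation: the components are pairwise distinct and have
   positive weights. *)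
Record mixture d (T : measurableType d) (R : realType) (m : nat) := Mixture {
  weight : 'I_m -> R ;
  component : 'I_m -> prob_meas T R ;
  weight_gt0 : forall i, 0 < weight i ;
  weight_sum1 : \sum_(i < m) weight i = 1 ;
  component_inj : injective component }.

Section convex_combination.
Context d (T : measurableType d) (R : realType) (m : nat).
Variable P : mixture T R m.
Context d' (S : measurableType d') (nu : 'I_m -> probability S R).
Local Open Scope ereal_scope.

Definition weighted_sum (A : set S) : \bar R :=
  \sum_(i < m) (weight P i)%:E * nu i A.

Let weighted_sum0 : weighted_sum set0 = 0.
Proof. by rewrite /weighted_sum big1// => i _; rewrite measure0 mule0. Qed.

Let weighted_sum_ge0 A : 0 <= weighted_sum A.
Proof.
by apply: sume_ge0 => i _; rewrite mule_ge0// lee_fin ltW// weight_gt0.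
Qed.

Let weighted_sum_sigma_additive : semi_sigma_additive weighted_sum.
Proof.
move=> F mF tF mUF; rewrite [X in _ --> X](_ : _ =
    lim ((fun n => \sum_(0 <= i < n) weighted_sum (F i)) @ \oo)).
  by apply: is_cvg_ereal_nneg_natsum => k _; exact: weighted_sum_ge0.
have w_ge0 i : 0 <= (weight P i)%:E by rewrite lee_fin ltW// weight_gt0.
rewrite nneseries_sum//; last by move=> i k _; apply: mule_ge0.
by apply: eq_bigr => /= i _; rewrite measure_semi_bigcup// nneseriesZl.
Qed.

HB.instance Definition _ := isMeasure.Build _ _ _ weighted_sum
  weighted_sum0 weighted_sum_ge0 weighted_sum_sigma_additive.

Let weighted_sumT : weighted_sum setT = 1.
Proof.
rewrite /weighted_sum; under eq_bigr do rewrite probability_setT mule1.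
by rewrite sumEFin weight_sum1.
Qed.

HB.instance Definition _ :=
  Measure_isProbability.Build _ _ _ weighted_sum weighted_sumT.

End convex_combination.

Section mixtures.
Context d (T : measurableType d) (R : realType).

Definition mixture_measure m (P : mixture T R m) :
    probability (prob_meas T R) R :=
  weighted_sum P (fun i => dirac (component P i)).

Definition V (n m : nat) (P : mixture T R m) : probability (n.-tuple T) R :=
  weighted_sum P (fun i => meas_power (component P i) n).

Definition n_determined (n m : nat) (P : mixture T R m) :=
  ~ exists (m' : nat) (P' : mixture T R m'),
      ~ eq_meas (mixture_measure P') (mixture_measure P) /\
      eq_meas (V n P') (V n P).

End mixtures.

(* Main.v *)
(* Take the distributions on {0, .., k - 1} proportional to the points
   v(x) = (1, x, .., x^(k - 1)) of the moment curve, x > 0: any k of them are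
   linearly independent (Vandermonde). The entries of the n-fold tensor power of
   v(x) are monomials in x of degree at most (k - 1) n < 2 m, so the alternating
   binomial sum of v(i + 1)^{(x) n} over 0 <= i <= 2 m vanishes. Moving the
   terms with odd i (m of them) and those with even i (m + 1 of them) to
   different sides gives, after normalization, two mixtures with the same V_n
   and disjoint sets of components. *)

Require Import Defs.
From mathcomp Require Import all_boot all_order all_algebra.
From mathcomp Require Import all_classical all_reals all_analysis.

Set Implicit Arguments.
Unset Strict Implicit.
Unset Printing Implicit Defensive.

Import Order.TTheory GRing.Theory Num.Theory.

Local Open Scope classical_set_scope.
Local Open Scope ring_scope.

(** * Alternating binomial sums of polynomial values *)

(** An [N]-th finite difference kills powers below [N]. In the induction on [q] one factor [i + a]
    is split off: the part with [a] is the case [q], and in the part with [i] the absorption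
    identity [mul_bin_diag] lowers [N] by one and shifts [a], which is why [a] is general. *)
Lemma alternating_binomial_pow (R : comNzRingType) (q N a : nat) : (q < N)%N ->
  \sum_(i < N.+1) (-1) ^+ i * 'C(N, i)%:R * (i + a)%:R ^+ q = 0 :> R.
Proof.
elim: q N a => [|q IHq] N a ltqN.
  transitivity ((1 - 1) ^+ N : R); last by rewrite subrr expr0n; case: N ltqN.
  rewrite exprBn; apply: eq_bigr => i _.
  by rewrite !expr1n expr0 !mulr1 mulr_natr.
case: N ltqN => // N; rewrite ltnS => ltqN.
under eq_bigr => i _ do rewrite exprS {1}natrD mulrDl mulrDr.
rewrite big_split /= [X in _ + X](_ : _ = 0) ?addr0.
  rewrite big_ord_recl mul0r mulr0 add0r.
  transitivity (- N.+1%:R *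
      \sum_(i < N.+1) (-1) ^+ i * 'C(N, i)%:R * (i + a.+1)%:R ^+ q : R).
    rewrite mulr_sumr; apply: eq_bigr => i _; rewrite lift0 addSnnS exprS.
    have := mul_bin_diag N.+1 i => /(congr1 (fun p => p%:R : R)) /=.
    rewrite !natrM => E; rewrite !mulN1r !mulNr -!mulrA; congr (- _).
    rewrite [RHS]mulrCA; congr (_ * _).
    by rewrite !mulrA E; congr (_ * _); rewrite mulrC.
  by rewrite IHq// mulr0.
under eq_bigr => i _ do rewrite mulrCA.
by rewrite -mulr_sumr IHq ?mulr0// ltnW.
Qed.

Lemma alternating_binomial_horner (R : comNzRingType) (N a : nat)
    (p : {poly R}) :
  (size p <= N)%N ->
  \sum_(i < N.+1) (-1) ^+ i * 'C(N, i)%:R * p.[(i + a)%:R] = 0.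
Proof.
move=> ltpN.
under eq_bigr => i _ do rewrite (horner_coef_wide _ ltpN) mulr_sumr.
rewrite exchange_big big1// => j _.
under eq_bigr => i _ do rewrite mulrCA.
by rewrite -mulr_sumr alternating_binomial_pow ?mulr0.
Qed.

Lemma sum_alternating (R : pzRingType) (m : nat) (F : nat -> R) :
  \sum_(i < (2 * m).+1) (-1) ^+ i * F i =
  \sum_(i < m.+1) F (2 * i)%N - \sum_(i < m) F (2 * i).+1.
Proof.
elim: m => [|m IHm]; first by rewrite muln0 !big_ord_recl !big_ord0 mul1r subr0.
rewrite mulnS add2n big_ord_recr big_ord_recr /= IHm.
rewrite [in X in _ = X - _]big_ord_recr [in X in _ = _ - X]big_ord_recr /=.
rewrite !exprS exprM sqrrN !expr1n !mulr1 !mulN1r opprK mul1r.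
by rewrite mulnS add2n opprD -!addrA; congr (_ + _); rewrite [RHS]addrC addrA.
Qed.

(** * Measures and mixtures evaluated on singletons *)

(** The fibres of [f] cut any measurable set into countably many disjoint pieces, each empty or a
    singleton. *)
Lemma eq_meas_countable d (T : measurableType d) (R : realType)
    (f : T -> nat) (mu nu : {measure set T -> \bar R}) :
  injective f -> (forall t : T, d.-measurable [set t]) ->
  (forall t, mu [set t] = nu [set t]) -> eq_meas mu nu.
Proof.
move=> finj m1 munu A mA.
pose F i := [set t | A t /\ f t = i].
have FE i : F i = set0 \/ exists t, F i = [set t].
  have [->|/set0P[t [At ft]]] := eqVneq (F i) set0; first by left.
  right; exists t; apply/seteqP; split => [u [Au fu]|u ->//].
  by apply: finj; rewrite fu.
have mF i : measurable (F i) by case: (FE i) => [->|[t ->]].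
have tF : trivIset setT F.
  apply/trivIsetP => i j _ _ ij; apply/seteqP; split => // t [[_ fi] [_ fj]].
  by move: ij; rewrite -fi -fj eqxx.
have -> : A = \bigcup_i F i.
  by apply/seteqP; split => [t At|t [i _ []]//]; exists (f t).
rewrite !measure_bigcup//=; apply: eq_eseriesr => i _.
by case: (FE i) => [->|[t ->]//]; rewrite !measure0.
Qed.

Section normalized_mixture.
Context d (T : measurableType d) (R : realType) (m : nat).
Variables (b : 'I_m -> R) (mu : 'I_m -> prob_meas T R).
Hypotheses (m_gt0 : (0 < m)%N) (b_gt0 : forall i, 0 < b i).
Hypothesis mu_inj : injective mu.

Lemma sum_pos_gt0 : 0 < \sum_i b i.
Proof.
rewrite (bigD1 (Ordinal m_gt0))//= ltr_pwDl//.
by apply: sumr_ge0 => i _; exact: ltW.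
Qed.

Let normalized_gt0 i : 0 < b i / \sum_j b j.
Proof. by rewrite divr_gt0// sum_pos_gt0. Qed.

Let normalized_sum1 : \sum_i b i / \sum_j b j = 1.
Proof. by rewrite -mulr_suml divff// gt_eqF// sum_pos_gt0. Qed.

Definition normalized_mixture : mixture T R m :=
  Mixture normalized_gt0 normalized_sum1 mu_inj.

End normalized_mixture.

Lemma mixture_measure_set1 d (T : measurableType d) (R : realType) (m : nat)
    (P : mixture T R m) (i : 'I_m) :
  mixture_measure P [set component P i] = (weight P i)%:E.
Proof.
rewrite /mixture_measure /= /weighted_sum (bigD1 i)//= big1 ?adde0.
  by rewrite diracE mem_set// mule1.
move=> j ji; rewrite diracE memNset ?mule0//= => /component_inj ij.
by rewrite ij eqxx in ji.
Qed.

Lemma mixture_measure_set1_out d (T : measurableType d) (R : realType)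
    (m : nat) (P : mixture T R m) (mu : prob_meas T R) :
  (forall i, component P i != mu) -> mixture_measure P [set mu] = 0%E.
Proof.
move=> Pmu; rewrite /mixture_measure /= /weighted_sum big1// => i _.
by rewrite /= diracE memNset ?mule0//=; exact/eqP.
Qed.

Lemma set1_tuple (T : Type) (n : nat) (t : n.-tuple T) :
  [set t] = [set u | forall l, [set tnth t l] (tnth u l)].
Proof.
by apply/seteqP; split => [u -> //|u ut]; exact: eq_from_tnth.
Qed.

Lemma V_set1 d (T : measurableType d) (R : realType) (n m : nat)
    (P : mixture T R m) (t : n.-tuple T) :
  (forall x : T, d.-measurable [set x]) ->
  V n P [set t] = (\sum_(i < m) (weight P i)%:E *
    \prod_(l < n) component P i [set tnth t l])%E.
Proof.
move=> m1; rewrite set1_tuple; apply: eq_bigr => i _; congr (_ * _)%E.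
exact: (@meas_powerE _ _ _ _ _ (fun l => [set tnth t l])).
Qed.

Lemma dirac_prob_meas_inj (R : realType) :
  injective (fun i : nat => prob_meas_of (\d_i : probability nat R)).
Proof.
move=> i j /prob_measP /(_ [set i] I); rewrite !prob_meas_ofE//=.
rewrite !diracE mem_set//=; case: (asboolP (i = j)) => // ij.
by rewrite memNset//= => [/eqP|/esym//]; rewrite onee_eq0.
Qed.

(** * Normalized points of the moment curve *)

Section geometric.
Context (R : realType) (k : nat).
Hypothesis k_gt0 : (0 < k)%N.

Definition geometric_sum (i : nat) : R := \sum_(j < k) i.+1%:R ^+ j.

Let powS_gt0 (i j : nat) : 0 < i.+1%:R ^+ j :> R.
Proof. by rewrite exprn_gt0. Qed.

Lemma geometric_sum_gt0 i : 0 < geometric_sum i.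
Proof. by apply: sum_pos_gt0. Qed.

Let dirac_ord_inj : injective
  (fun j : 'I_k => prob_meas_of (\d_(j : nat) : probability nat R)).
Proof. by move=> i j /dirac_prob_meas_inj /val_inj. Qed.

(* The distribution on [{0, .., k - 1}] proportional to the point
   [(1, x, .., x ^+ (k - 1))] of the moment curve at [x = i + 1]. *)
Definition geometric (i : nat) : prob_meas nat R :=
  prob_meas_of (weighted_sum
    (normalized_mixture k_gt0 (fun j : 'I_k => powS_gt0 i j) dirac_ord_inj)
    (fun j : 'I_k => \d_(j : nat) : probability nat R)).

Lemma geometric_set1 i j : geometric i [set j] =
  (if (j < k)%N then i.+1%:R ^+ j / geometric_sum i else 0)%:E.
Proof.
rewrite prob_meas_ofE//= /weighted_sum /= -/(geometric_sum i); case: ifPn => jk.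
  rewrite (bigD1 (Ordinal jk))//= diracE mem_set//= mule1 big1 ?adde0//.
  move=> l lj; rewrite diracE memNset ?mule0//= => /esym ljE.
  by move: lj; rewrite -val_eqE /= ljE eqxx.
rewrite big1// => l _; rewrite diracE memNset ?mule0//= => lj.
by move: jk; rewrite -lj ltn_ord.
Qed.

(** The mass at 0 is the inverse of the normalizing constant; once the constants agree, the mass at
    1 recovers the parameter. *)
Lemma geometric_inj : (1 < k)%N -> injective geometric.
Proof.
move=> k_gt1 i j ij.
have /eqP := congr1 (fun mu : prob_meas nat R => mu [set 0%N]) ij.
have /eqP := congr1 (fun mu : prob_meas nat R => mu [set 1%N]) ij.
rewrite /= !geometric_set1 k_gt0 k_gt1 !eqe !expr1 !expr0 !mul1r.
move=> + /eqP/invr_inj sij; rewrite sij => /eqP.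
have sj0 : (geometric_sum j)^-1 != 0.
  by rewrite invr_eq0 gt_eqF// geometric_sum_gt0.
by move=> /(mulIf sj0)/eqP; rewrite eqr_nat eqSS => /eqP.
Qed.

(** Evaluating a vanishing combination at the points [j < k] gives a row vector, with the
    normalizing constants absorbed in its entries, killed by a transposed Vandermonde matrix. Its
    nodes are distinct because [s] is increasing and [e] injective. *)
Lemma geometric_k_independent m (e : 'I_m -> nat) :
  injective e -> k_independent k (fun i => signed_meas_of (geometric (e i))).
Proof.
move=> e_inj s s_mono c /signed_comb_eq0P c0.
pose x : 'rV[R]_k := \row_i (e (s i)).+1%:R.
pose v : 'rV[R]_k := \row_i (c i / geometric_sum (e (s i))).
have v0 : v *m (Vandermonde k x)^T = 0.
  apply/rowP => j; rewrite !mxE -[RHS](c0 [set (j : nat)])//.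
  apply: eq_bigr => i _.
  by rewrite !mxE geometric_set1 ltn_ord /= mulrAC mulrA.
have xU : (Vandermonde k x)^T \in unitmx.
  rewrite unitmx_tr unitmxE det_Vandermonde unitfE.
  apply/prodf_neq0 => i _; apply/prodf_neq0 => j ij.
  rewrite !mxE subr_eq0 eqr_nat eqSS; apply: contraTneq (s_mono _ _ ij).
  by move=> /e_inj ->; rewrite ltnn.
move=> i; have /rowP/(_ i) : v = 0 by rewrite -(mulmxK xU v) v0 mul0mx.
rewrite !mxE => /eqP.
by rewrite mulf_eq0 invr_eq0 (gt_eqF (geometric_sum_gt0 _)) orbF => /eqP.
Qed.

End geometric.

(** * Mixtures with binomial weights *)

Section binomial_mixture.
Context (R : realType) (k n N : nat).
Hypothesis k_gt1 : (1 < k)%N.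

Let k_gt0 : (0 < k)%N. Proof. exact: ltnW. Qed.

Definition binomial_coef (i : nat) : R :=
  'C(N, i)%:R * geometric_sum R k i ^+ n.

Context (m : nat) (e : 'I_m -> nat).
Hypotheses (m_gt0 : (0 < m)%N) (e_inj : injective e).
Hypothesis e_le : forall i, (e i <= N)%N.

Let coef_gt0 i : 0 < binomial_coef (e i).
Proof. by rewrite mulr_gt0 ?ltr0n ?bin_gt0// exprn_gt0// geometric_sum_gt0. Qed.

Let comp_inj : injective (fun i => geometric R k_gt0 (e i)).
Proof. by move=> i j /(geometric_inj k_gt1) /e_inj. Qed.

(** The map [e] selects the terms on one side of the alternating identity; the weights are positive
    since the signs are left out. *)
Definition binomial_mixture : mixture nat R m :=
  normalized_mixture m_gt0 coef_gt0 comp_inj.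

(* The factor [geometric_sum ^+ n] in the weights cancels the normalization of
   the [n]-fold products, leaving a polynomial in the parameter. *)
Lemma V_binomial_mixture_set1 (t : n.-tuple nat) :
  V n binomial_mixture [set t] =
  ((\sum_(i < m) 'C(N, e i)%:R *
     (\prod_(l < n) (if (tnth t l < k)%N then 'X^(tnth t l) else 0)
        : {poly R}).[(e i).+1%:R]) /
   \sum_(i < m) binomial_coef (e i))%:E.
Proof.
rewrite V_set1// mulr_suml -sumEFin; apply: eq_bigr => i _.
under eq_bigr do rewrite geometric_set1.
rewrite prodEFin -EFinM; congr EFin => /=; rewrite mulrAC; congr (_ / _).
rewrite -mulrA; congr (_ * _); rewrite horner_prod.
rewrite -[n in _ ^+ n](card_ord n) -prodr_const -big_split /=.
apply: eq_bigr => l _; case: ifP => _; last by rewrite mulr0 horner0.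
by rewrite hornerXn mulrC divfK// gt_eqF// geometric_sum_gt0.
Qed.

End binomial_mixture.

(** * Degree bounds and the parity split *)

Lemma size_prod_leq_exp (R : comNzRingType) (k n : nat)
    (p : 'I_n -> {poly R}) :
  (forall l, (size (p l) <= k.+1)%N) ->
  (size (\prod_(l < n) p l)%R <= (k * n).+1)%N.
Proof.
elim: n p => [|n IHn] p pk; first by rewrite big_ord0 size_poly1.
rewrite big_ord_recr /= mulnS addnC.
apply: leq_trans (size_polyMleq _ _) _.
have := leq_add (IHn (fun l => p (widen_ord (leqnSn n) l)) (fun l => pk _))
  (pk ord_max).
by case: (_ + _)%N => //= u; rewrite addnS addSn !ltnS.
Qed.

(** This is the vanishing [2 * m]-th difference at the nodes 1, .., 2m + 1, separated by the sign of
    its terms. *)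
Lemma binomial_horner_even_odd (R : comNzRingType) (m : nat) (p : {poly R}) :
  (size p <= 2 * m)%N ->
  \sum_(i < m.+1) 'C(2 * m, 2 * i)%:R * p.[(2 * i).+1%:R] =
  \sum_(i < m) 'C(2 * m, (2 * i).+1)%:R * p.[(2 * i).+2%:R].
Proof.
move=> pm; apply/eqP; rewrite -subr_eq0; apply/eqP.
have <- := sum_alternating m (fun i => 'C(2 * m, i)%:R * p.[i.+1%:R]).
rewrite -[RHS](alternating_binomial_horner 1 pm).
by apply: eq_bigr => i _; rewrite mulrA addn1.
Qed.

Theorem theorem4p4 (R : realType) (m k n : nat)
    (hk : (2 <= k)%N) (hkm : (k <= m)%N) (hn : (0 < n)%N)
    (hmn : ((k - 1) * n < 2 * m)%N) :
  exists (d : measure_display) (T : measurableType d) (P : mixture T R m),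
    k_independent k (fun i => signed_meas_of (component P i)) /\
    ~ n_determined n P.
Proof.
have m_gt0 : (0 < m)%N by apply: leq_trans hkm; exact: ltnW.
have odd_inj : injective (fun i : 'I_m => (2 * i).+1).
  by move=> i j /eqP; rewrite eqSS eqn_pmul2l// => /eqP/val_inj.
have even_inj : injective (fun i : 'I_m.+1 => (2 * i)%N).
  by move=> i j /eqP; rewrite eqn_pmul2l// => /eqP/val_inj.
have odd_le (i : 'I_m) : ((2 * i).+1 <= 2 * m)%N by rewrite ltn_pmul2l.
have even_le (i : 'I_m.+1) : (2 * i <= 2 * m)%N.
  by rewrite leq_pmul2l// -ltnS.
pose P : mixture nat R m := binomial_mixture R n hk m_gt0 odd_inj odd_le.
pose P' : mixture nat R m.+1 :=
  binomial_mixture R n hk (ltn0Sn m) even_inj even_le.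
exists _, nat, P; split; first exact: geometric_k_independent.
apply; exists m.+1, P'; split.
  (* The parameter of [component P' ord0] has index 0, which is not odd: [P'] charges this point and
     [P] does not. *)
  move=> /(_ [set component P' ord0] I).
  rewrite mixture_measure_set1 mixture_measure_set1_out.
    by move=> /eqP; rewrite eqe gt_eqF// weight_gt0.
  move=> i; apply/eqP => /(geometric_inj hk) /=.
  by rewrite muln0.
(* Each factor has degree at most k - 1, and [hmn] says that (k - 1) n + 1 is at most 2m. *)
have size_le : forall p : 'I_n -> {poly R},
    (forall l, (size (p l) <= k)%N) -> (size (\prod_l p l)%R <= 2 * m)%N.
  move=> p pk; apply: leq_trans hmn; apply: size_prod_leq_exp => l.
  by rewrite subn1 prednK// ltnW.
(* The normalizing constants agree by the same identity, applied to the polynomial (1 + X + .. +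
   X^(k - 1))^n. *)
have sumE : \sum_(i < m.+1) binomial_coef R k n (2 * m) (2 * i) =
    \sum_(i < m) binomial_coef R k n (2 * m) (2 * i).+1.
  have coefE i : binomial_coef R k n (2 * m) i = 'C(2 * m, i)%:R *
      (\prod_(l < n) \sum_(j < k) 'X^j : {poly R}).[i.+1%:R].
    rewrite horner_prod prodr_const card_ord horner_sum.
    by congr (_ * _ ^+ _); apply: eq_bigr => j _; rewrite hornerXn.
  under eq_bigr do rewrite coefE; under [RHS]eq_bigr do rewrite coefE.
  apply: binomial_horner_even_odd; apply: size_le => _.
  rewrite (leq_trans (size_sum _ _ _))//; apply/bigmax_leqP => j _.
  by rewrite size_polyXn.
apply: (@eq_meas_countable _ _ _ (pickle : n.-tuple nat -> nat)).
- exact: pcan_inj pickleK.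
- move=> t; rewrite set1_tuple.
  exact: (@measurable_rect _ _ _ (fun l => [set tnth t l])).
move=> t; change (V n P' [set t] = V n P [set t]).
rewrite !V_binomial_mixture_set1 sumE.
rewrite binomial_horner_even_odd//.
(* A coordinate of [t] outside the support contributes the zero polynomial. *)
apply: size_le => l; case: ifP => tl; last by rewrite size_poly0.
by rewrite size_polyXn.
Qed.
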